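(* Let $\mathcal{X}$ and $\mathcal{X}'$ be two polyhedral structures of a tropical cycle $X$. Then $V_{\mathcal{X}}\cong V_{\mathcal{X}'}$, and similarly $\Lambda_{\mathcal{X}}\cong\Lambda_{\mathcal{X}'}$.
   Context: For a polyhedron $\sigma\subset\mathbb{R}^n$, $V_\sigma := \langle a-b : a,b\in\sigma\rangle$ and $\Lambda_\sigma := V_\sigma\cap\mathbb{Z}^n$. If $\tau$ is a codimension one face of the rational polyhedron $\sigma$ and $g$ is an integral linear form whose minimal locus on $\sigma$ is $\tau$, then $u_{\sigma/\tau}$ denotes the unique generator of $\Lambda_\sigma/\Lambda_\tau\cong\mathbb{Z}$ with $g(u_{\sigma/\tau})>0$. A tropical cycle $(X,\omega)$ is a pure rational $d$-dimensional polyhedral complex in $\mathbb{R}^n$ with a weight function $\omega$ from its $d$-dimensional cells to $\mathbb{Z}$ such that for every $(d-1)$-dimensional cell $\tau$, $\sum_{\sigma>\tau}\omega(\sigma)u_{\sigma/\tau}=0$ in $\mathbb{R}^n/V_\tau$ (balancing condition). Two tropical cycles are considered equivalent if they have the same support (union of all cells) and there is a finer polyhedral structure on this support that respects both weight functions; a polyhedral structure $\mathcal{X}$ of $X$ is a specific choice of weighted complex representing $X$. Let $\mathcal{X}$ be a polyhedral structure of $X$ with maximal cells $\sigma_1,\dots,\sigma_N$. An integer vector $\omega\in\mathbb{Z}^N$ is identified with the weight function $\sigma_i\mapsto\omega_i$. Define $\Lambda_{\mathcal{X}} := \{\omega\in\mathbb{Z}^N : (\mathcal{X},\omega)\text{ is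 balanced}\}$ (a lattice) and $V_{\mathcal{X}} := \Lambda_{\mathcal{X}}\otimes\mathbb{R}\subseteq \mathbb{R}^N$, so $\Lambda_{\mathcal{X}}=V_{\mathcal{X}}\cap\mathbb{Z}^N$. *)

(* Defs.v *)
From HB Require Import structures.
From mathcomp Require Import all_boot all_order all_algebra.
From mathcomp Require Import all_classical reals.

Set Implicit Arguments.
Unset Strict Implicit.
Unset Printing Implicit Defensive.

Import Order.TTheory GRing.Theory Num.Theory.
Local Open Scope classical_set_scope.
Local Open Scope ring_scope.

Section LinearSpan.
Context (K : fieldType) (vT : vectType K).

Lemma vspan_exists (A : set vT) :
  exists U : {vspace vT}, (forall v, A v -> v \in U) /\
    (forall W : {vspace vT}, (forall v, A v -> v \in W) -> (U <= W)%VS).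
Proof.
pose P k := `[< exists2 U : {vspace vT}, forall v, A v -> v \in U & \dim U = k >].
have exP : exists k, P k.
  by exists (\dim {:vT}); apply/asboolP; exists fullv => // v _; rewrite memvf.
case: (ex_minnP exP) => k /asboolP[U AU dU] kmin; exists U; split=> // W AW.
have dUW : (\dim U <= \dim (U :&: W))%N.
  rewrite dU; apply: kmin; apply/asboolP; exists (U :&: W)%VS => // v Av.
  by rewrite memv_cap AU ?AW.
have /eqP <- : (U :&: W == U)%VS by rewrite eqEdim capvSl.
exact: capvSr.
Qed.

(* The linear span of an arbitrary, possibly infinite, set of vectors: the
   smallest subspace containing it. *)
Definition vspan (A : set vT) : {vspace vT} := sval (cid (vspan_exists A)).

End LinearSpan.

Section Polyhedra.
Context (R : realType) (n : nat).
Implicit Types (s t : set 'rV[R]_n) (a x y : 'rV[R]_n).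

Definition toR (m : nat) (v : 'rV[int]_m) : 'rV[R]_m := map_mx intr v.

Definition linform a x : R := \sum_(j < n) a 0 j * x 0 j.

(* Integral linear forms, but arbitrary real constant terms; an equation is a
   pair of opposite inequalities. *)
Definition rational_polyhedron s :=
  exists (m : nat) (g : 'I_m -> 'rV[int]_n) (b : 'I_m -> R),
    s = [set x | forall i, b i <= linform (toR (g i)) x].

Definition minlocus a s : set 'rV[R]_n :=
  [set x | s x /\ forall y, s y -> linform a x <= linform a y].

(* Faces are nonempty, and s is a face of itself (for the zero form). *)
Definition face t s := t !=set0 /\ exists a, t = minlocus a s.

Definition Vspace s : {vspace 'rV[R]_n} :=
  vspan [set v | exists a b, [/\ s a, s b & v = a - b]].

Definition pdim s : nat := \dim (Vspace s).

Definition in_lattice s (v : 'rV[int]_n) := toR v \in Vspace s.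

(* u represents the generator u_{s/t} of the quotient of the lattices of s
   and t. *)
Definition is_lattice_normal s t (u : 'rV[int]_n) :=
  [/\ in_lattice s u,
      forall v, in_lattice s v -> exists k : int, in_lattice t (v - u *~ k)
    & exists2 g : 'rV[int]_n, minlocus (toR g) s = t & 0 < linform (toR g) (toR u)].

(* A representative in the lattice of s of the class u_{s/t}; the class, hence
   the balancing condition below, does not depend on the choice. *)
Definition lattice_normal s t : 'rV[int]_n := xget 0 (is_lattice_normal s t).

End Polyhedra.

Definition maximal_cell (T : Type) (C : set (set T)) (s : set T) :=
  C s /\ forall t, C t -> s `<=` t -> t = s.

(* A pure d-dimensional rational polyhedral complex, together with an
   enumeration of its maximal cells. *)
Record polyComplex (R : realType) (n d : nat) := PolyComplex {
  cells : set (set 'rV[R]_n);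
  ncells : nat;
  mcell : 'I_ncells -> set 'rV[R]_n;
  _ : finite_set cells;
  _ : forall s, cells s -> s !=set0 /\ rational_polyhedron s;
  _ : forall s t, cells s -> face t s -> cells t;
  _ : forall s t, cells s -> cells t -> s `&` t !=set0 ->
        face (s `&` t) s /\ face (s `&` t) t;
  _ : forall s, maximal_cell cells s -> pdim s = d;
  _ : injective mcell;
  _ : range mcell = maximal_cell cells }.

Section Weights.
Context (R : realType) (n d : nat).
Implicit Type X : polyComplex R n d.

Definition support X : set 'rV[R]_n := [set x | exists2 s, cells X s & s x].

(* Equality to 0 modulo V_t is expressed as membership in V_t. *)
Definition balanced X (w : 'rV[int]_(ncells X)) :=
  forall t, cells X t -> (pdim t).+1 = d ->
    \sum_(i | `[< face t (mcell i) >])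
      toR R (lattice_normal (mcell i) t) *~ w 0 i \in Vspace t.

Definition balanced_pred X : pred 'rV[int]_(ncells X) :=
  fun w => `[< balanced w >].

Arguments balanced_pred : clear implicits.

Lemma balanced_zmod_closed X : zmod_closed (balanced_pred X).
Proof.
split; first by apply/asboolP => t _ _; rewrite big1 ?mem0v // => i _; rewrite mxE mulr0z.
move=> v w /asboolP bv /asboolP bw; apply/asboolP => t Xt dt.
under eq_bigr do rewrite mxE mxE mulrzBr.
by rewrite sumrB rpredB ?bv ?bw.
Qed.

HB.instance Definition _ X :=
  GRing.isZmodClosed.Build 'rV[int]_(ncells X) (balanced_pred X)
    (balanced_zmod_closed X).

Record Lambda X := MkLambda
  { weight_of :> 'rV[int]_(ncells X); _ : weight_of \in balanced_pred X }.

HB.instance Definition _ X := [isSub for @weight_of X].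
HB.instance Definition _ X := [Choice of Lambda X by <:].
HB.instance Definition _ X := [SubChoice_isSubZmodule of Lambda X by <:].

(* The tensor product of Lambda with the reals, as a subspace of R^N. *)
Definition VX X : {vspace 'rV[R]_(ncells X)} :=
  vspan [set v | exists2 w, balanced w & v = toR R w].

Definition refines (Y X : polyComplex R n d) :=
  support Y = support X /\
  forall t, cells Y t -> exists2 s, cells X s & t `<=` s.

Definition respects (Y X : polyComplex R n d)
    (wY : 'rV[int]_(ncells Y)) (w : 'rV[int]_(ncells X)) :=
  forall i j, mcell i `<=` mcell j -> wY 0 i = w 0 j.

End Weights.

(* A weighted balanced complex, i.e. one polyhedral structure of the tropical
   cycle that is its class under [same_cycle]. *)
Record polyStructure (R : realType) (n d : nat) := PolyStructure {
  pcomplex :> polyComplex R n d;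
  pweight : 'rV[int]_(ncells pcomplex);
  _ : balanced pweight }.

Definition same_cycle (R : realType) (n d : nat) (X X' : polyStructure R n d) :=
  support X = support X' /\
  exists (Y : polyComplex R n d) (wY : 'rV[int]_(ncells Y)),
    [/\ refines Y X, refines Y X', respects wY (pweight X)
      & respects wY (pweight X')].

(* Main.v *)
Require Import Defs.
From HB Require Import structures.
From mathcomp Require Import all_boot all_order all_algebra.
From mathcomp Require Import all_classical reals.
From mathcomp Require Import ring lra.

Set Implicit Arguments.
Unset Strict Implicit.
Unset Printing Implicit Defensive.

Import Order.TTheory GRing.Theory Num.Theory.
Local Open Scope classical_set_scope.
Local Open Scope ring_scope.

(** Let [Y] refine [X]. Each maximal cell of [Y] lies in exactly one maximal cell
    of [X], its parent, and weights on [X] pull back along this map; the pull-back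
    is injective because every maximal cell of [X] is a parent. The theorem holds
    because the pull-back identifies the balanced weights of [X] with those of
    [Y]: for a common refinement [Y] of [X] and [X'], both lattices are then
    isomorphic to that of [Y], and the real spans have the same dimension.

    A codimension one cell [t'] of [Y] has a relative interior point in the
    relative interior of a unique cell [t] of [X], which contains [t'] and has
    dimension [d - 1] or [d].
    - If [t] is itself a wall of [X], the two complexes look alike around the
      point: same spans, same maximal cells up to passing to the parent, same
      lattice normals. The two balancing conditions coincide
      ([wall_balancing_sum]).
    - If [t] is maximal, exactly two maximal cells of [Y] contain [t'], with
      opposite lattice normals, and balancing means that their weights are equal
      ([interior_balancing_sum]).

    Hence pull-backs of balanced weights are balanced ([balanced_pullback]).
    Conversely, a balanced weight on [Y] is constant on the cells with a given
    parent, because two of them can be joined by a segment that avoids all cells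
    of codimension at least two and thus changes cells only across walls
    ([balanced_constant]); so it is a pull-back, and it is balanced on [X] because
    every wall of [X] contains a wall of [Y] through one of its relative interior
    points ([refined_wall]).

    The local geometry rests on germs: along any ray from a point, a polyhedron
    either contains or misses a whole initial piece of the ray, so a ray that
    starts in a finite union of polyhedra starts in one of them. The class
    [lattice_normal] is meaningful only if a lattice normal exists
    ([lattice_normal_exists]); this uses rationality, through the fact that a
    form vanishing on the lattice vectors of a rational polyhedron vanishes on
    its span ([lattice_dense]). *)

(** * Germs at zero from the right *)

Section Germs.
Context (R : realType).
Implicit Types (P Q : R -> Prop).

Definition near0 P := exists2 e : R, 0 < e & forall d, 0 < d -> d <= e -> P d.

Lemma near0_and P Q : near0 P -> near0 Q -> near0 (fun d => P d /\ Q d).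
Proof.
move=> [e e0 Pe] [f f0 Qf]; exists (Num.min e f); first by rewrite lt_min e0.
by move=> d d0; rewrite le_min => /andP[de df]; split; [apply: Pe|apply: Qf].
Qed.

Lemma near0_imp P Q : (forall d, 0 < d -> P d -> Q d) -> near0 P -> near0 Q.
Proof. by move=> PQ [e e0 Pe]; exists e => // d d0 de; apply: PQ => //; apply: Pe. Qed.

Lemma near0_ex P : near0 P -> exists2 d, 0 < d & P d.
Proof. by move=> [e e0 Pe]; exists e => //; apply: Pe. Qed.

Lemma near0_all (I : finType) (P : I -> R -> Prop) :
  (forall i, near0 (P i)) -> near0 (fun d => forall i, P i d).
Proof.
move=> nP; suff: forall s : seq I, near0 (fun d => forall i, i \in s -> P i d).
  by move=> /(_ (enum I)); apply: near0_imp => d _ Pd i; apply: Pd; rewrite mem_enum.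
elim=> [|i s IH]; first by exists 1.
apply: near0_imp (near0_and (nP i) IH) => d _ [Pi Ps] j.
by rewrite inE => /orP[/eqP->//|/Ps].
Qed.

Lemma near0_affine_lt (b c e : R) : b < c -> near0 (fun d => b < c + d * e).
Proof.
move=> bc; exists ((c - b) / (`|e| + 1) / 2).
  by rewrite !divr_gt0 ?subr_gt0// ltr_wpDl.
move=> d d0; rewrite -mulrA -invfM ler_pdivlMr; last by have := normr_ge0 e; lra.
have := ler_norm (- e); rewrite normrN => He Hd.
have : d * - e <= d * `|e| by rewrite ler_pM2l.
lra.
Qed.

Lemma near0_affine (b c e : R) :
  near0 (fun d => b <= c + d * e) \/ near0 (fun d => ~ b <= c + d * e).
Proof.
have [bc|cb|->] := ltgtP b c.
- by left; apply: near0_imp (near0_affine_lt e bc) => d _ /ltW.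
- right; have := near0_affine_lt (- e) (_ : - b < - c).
  rewrite ltrN2 => /(_ cb); apply: near0_imp => d _; lra.
- have [e0|e0] := leP 0 e; [left|right]; exists 1 => // d d0 _.
    by rewrite lerDl mulr_ge0// ltW.
  by have := nmulr_llt0 d e0; rewrite d0; lra.
Qed.

(** Properties that hold on a whole germ or fail on a whole germ obey the
    pigeonhole principle. *)
Lemma near0_pigeonhole (I : finType) (P : I -> R -> Prop) :
  (forall i, near0 (P i) \/ near0 (fun d => ~ P i d)) ->
  near0 (fun d => exists i, P i d) -> exists i, near0 (P i).
Proof.
move=> dP nP; apply/not_existsP => noP.
have /near0_all nN : forall i, near0 (fun d => ~ P i d).
  by move=> i; case: (dP i) => // /noP.
by have /near0_ex[d d0 [[i Pi] /(_ i)]] := near0_and nP nN.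
Qed.

End Germs.

(** * Linear forms and spans *)

Section Spans.
Context (K : fieldType) (vT : vectType K).

Lemma mem_vspan (A : set vT) v : A v -> v \in vspan A.
Proof. by rewrite /vspan; case: cid => U [AU _] /=; apply: AU. Qed.

Lemma vspan_min (A : set vT) (W : {vspace vT}) :
  (forall v, A v -> v \in W) -> (vspan A <= W)%VS.
Proof. by rewrite /vspan; case: cid => U [_ minU] /=; apply: minU. Qed.

End Spans.

Section LinForms.
Context (R : realType) (n : nat).
Implicit Types (s t : set 'rV[R]_n) (a h p q v w x y : 'rV[R]_n) (c d : R).

Lemma linformD a x y : linform a (x + y) = linform a x + linform a y.
Proof. by rewrite /linform -big_split/=; apply: eq_bigr => j _; rewrite mxE mulrDr. Qed.

Lemma linformZ a c x : linform a (c *: x) = c * linform a x.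
Proof.
by rewrite /linform mulr_sumr; apply: eq_bigr => j _; rewrite mxE mulrCA.
Qed.

Lemma linformN a x : linform a (- x) = - linform a x.
Proof. by rewrite -scaleN1r linformZ mulN1r. Qed.

Lemma linformB a x y : linform a (x - y) = linform a x - linform a y.
Proof. by rewrite linformD linformN. Qed.

Lemma linform0 a : linform a 0 = 0.
Proof. by rewrite -(scale0r 0) linformZ mul0r. Qed.

Lemma linformNl a x : linform (- a) x = - linform a x.
Proof.
by rewrite /linform -sumrN; apply: eq_bigr => j _; rewrite mxE mulNr.
Qed.

Lemma linform_suml (I : Type) (r : seq I) (P : pred I) (F : I -> 'rV[R]_n) x :
  linform (\sum_(i <- r | P i) F i) x = \sum_(i <- r | P i) linform (F i) x.
Proof.
rewrite /linform exchange_big/=; apply: eq_bigr => j _.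
by rewrite summxE mulr_suml.
Qed.

(** The same form with values in the vector space [R^o], as [linfun] requires. *)
Definition linform_fun a : 'rV[R]_n -> R^o := linform a.

Lemma linform_fun_linear a : linear (linform_fun a).
Proof. by move=> c x y; rewrite /linform_fun linformD linformZ. Qed.

HB.instance Definition _ a :=
  GRing.isLinear.Build R 'rV[R]_n R^o _ (linform_fun a) (linform_fun_linear a).

Definition linker a : {vspace 'rV[R]_n} := lker (linfun (linform_fun a)).

Lemma mem_linker a v : (v \in linker a) = (linform a v == 0).
Proof. by rewrite memv_ker lfunE. Qed.

Lemma Vspace_sub s x y : s x -> s y -> x - y \in Vspace s.
Proof. by move=> sx sy; apply: mem_vspan; exists x, y. Qed.

Lemma Vspace_min s (W : {vspace 'rV[R]_n}) :
  (forall x y, s x -> s y -> x - y \in W) -> (Vspace s <= W)%VS.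
Proof. by move=> sW; apply: vspan_min => v [x [y [sx sy ->]]]; apply: sW. Qed.

Lemma subset_Vspace s t : s `<=` t -> (Vspace s <= Vspace t)%VS.
Proof. by move=> st; apply: Vspace_min => x y /st tx /st ty; apply: Vspace_sub. Qed.

Lemma Vspace_const a s : (forall x y, s x -> s y -> linform a x = linform a y) ->
  forall v, v \in Vspace s -> linform a v = 0.
Proof.
move=> sa v sv; apply/eqP; rewrite -mem_linker; apply: subvP sv.
by apply: Vspace_min => x y sx sy; rewrite mem_linker linformB (sa _ y)// subrr.
Qed.

Lemma Vspace_germ s p v : s p -> near0 (fun d => s (p + d *: v)) -> v \in Vspace s.
Proof.
move=> sp /near0_ex[d d0 sd]; have := Vspace_sub sd sp.
by rewrite addrC addKr rpredZeq gt_eqF.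
Qed.

End LinForms.
(** * Relative interiors *)

Section Polyhedra.
Context (R : realType) (n : nat).
Implicit Types (s t : set 'rV[R]_n) (a h p q v w x y : 'rV[R]_n) (c d : R).

Lemma poly_germ s p v : rational_polyhedron s ->
  near0 (fun d => s (p + d *: v)) \/ near0 (fun d => ~ s (p + d *: v)).
Proof.
move=> [m [g [b ->]]] /=.
pose P i d := b i <= linform (toR R (g i)) p + d * linform (toR R (g i)) v.
have PE d i : (b i <= linform (toR R (g i)) (p + d *: v)) = P i d.
  by rewrite linformD linformZ.
have [nP|/existsNP[i nPi]] := pselect (forall i, near0 (P i)).
  by left; apply: near0_imp (near0_all nP) => d _ Pd i; rewrite PE.
right; have [//|] := near0_affine (b i) (linform (toR R (g i)) p) (linform (toR R (g i)) v).
by apply: near0_imp => d _ Pd /(_ i); rewrite PE.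
Qed.

Lemma poly_closed s p v : rational_polyhedron s ->
  near0 (fun d => s (p + d *: v)) -> s p.
Proof.
move=> [m [g [b ->]]] /= sp i; rewrite leNgt; apply/negP => ip.
have := near0_affine_lt (- linform (toR R (g i)) v) (_ : - b i < - linform (toR R (g i)) p).
rewrite ltrN2 => /(_ ip) /(near0_and sp)/near0_ex[d d0 [/(_ i)]].
rewrite linformD linformZ; lra.
Qed.

Lemma poly_convex s x y c : rational_polyhedron s -> s x -> s y ->
  0 <= c <= 1 -> s (x + c *: (y - x)).
Proof.
move=> [m [g [b ->]]] /= sx sy /andP[c0 c1] i.
rewrite linformD linformZ linformB.
have := sx i; have := sy i; move: (linform _ _) (linform _ _) => u w; nra.
Qed.

Lemma poly_convex_comb s x y c d : rational_polyhedron s -> s x -> s y ->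
  0 <= c -> 0 <= d -> c + d = 1 -> s (c *: x + d *: y).
Proof.
move=> Ps sx sy c0 d0 cd1; have -> : c *: x + d *: y = x + d *: (y - x).
  have -> : c = 1 - d by lra.
  by apply/rowP => j; rewrite !mxE; ring.
by apply: poly_convex => //; rewrite d0 -cd1 lerDr.
Qed.

Lemma poly_segment s p v c d : rational_polyhedron s -> s p -> s (p + c *: v) ->
  0 <= d <= c -> s (p + d *: v).
Proof.
move=> Ps sp sc /andP[d0 dc]; have [c0|c0] := leP c 0.
  have -> : d = 0 by lra.
  by rewrite scale0r addr0.
have := @poly_convex s p (p + c *: v) (d / c) Ps sp sc.
rewrite [p + _ - p]addrC addKr scalerA divfK ?gt_eqF//; apply.
by rewrite divr_ge0 // ?ler_pdivrMr ?mul1r // ltW.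
Qed.

Lemma poly_near0 s p v c : rational_polyhedron s -> s p -> 0 < c ->
  s (p + c *: v) -> near0 (fun d => s (p + d *: v)).
Proof.
move=> Ps sp c0 sc; exists c => // d d0 dc.
by apply: poly_segment sc _ => //; rewrite (ltW d0).
Qed.

(** The algebraic form of the relative interior: the point can be moved inside
    the set along every direction of its span. *)
Definition relint s p :=
  s p /\ forall v, v \in Vspace s -> near0 (fun d => s (p + d *: v)).

Lemma relint_in s p : relint s p -> s p. Proof. by case. Qed.

(** If [p] can be moved to [p + e v], then the point [p + c (x - p)] can be moved
    along [v] as well, by the homothety of centre [x] and ratio [1 - c]. *)
Lemma relint_segment s p x c : rational_polyhedron s -> relint s p -> s x ->
  0 <= c < 1 -> relint s (p + c *: (x - p)).
Proof.
move=> Ps [sp rp] sx /andP[c0 c1]; split.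
  by apply: poly_convex; rewrite // c0 ltW.
move=> v /rp /near0_ex[e e0 se].
have d0 : 0 < 1 - c by rewrite subr_gt0.
apply: (@poly_near0 _ _ _ ((1 - c) * e)); rewrite ?mulr_gt0 //.
  by apply: poly_convex; rewrite // c0 ltW.
have -> : p + c *: (x - p) + ((1 - c) * e) *: v = c *: x + (1 - c) *: (p + e *: v).
  by apply/rowP => j; rewrite !mxE; ring.
by apply: poly_convex_comb => //; [exact: ltW|rewrite addrC subrK].
Qed.

Lemma relint_move s p v : rational_polyhedron s -> relint s p -> v \in Vspace s ->
  near0 (fun d => relint s (p + d *: v)).
Proof.
move=> Ps rp /rp.2 /near0_ex[e e0 se]; exists (e / 2); first by rewrite divr_gt0.
move=> d d0 de; have := @relint_segment s p (p + e *: v) (d / e) Ps rp se.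
rewrite [p + _ - p]addrC addKr scalerA divfK ?gt_eqF//; apply.
by rewrite ltr_pdivrMr // mul1r divr_ge0 ?ltW //=; lra.
Qed.

(** At a point whose active inequalities are equations on the set, all the
    other inequalities are slack, hence survive a small displacement. *)
Lemma relint_active m (g : 'I_m -> 'rV[R]_n) (b : 'I_m -> R) s p :
    s p -> (forall x i, s x -> b i <= linform (g i) x) ->
    (forall x, (forall i, b i <= linform (g i) x) ->
       (forall i, linform (g i) p = b i -> linform (g i) x = b i) -> s x) ->
    (forall i, linform (g i) p = b i -> forall x, s x -> linform (g i) x = b i) ->
  relint s p.
Proof.
move=> sp sb bs act; split=> // v sv.
have actv i : linform (g i) p = b i -> linform (g i) v = 0.
  move=> ip; apply: (@Vspace_const _ _ _ s) => // x y sx sy.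
  by rewrite (act i ip x) // (act i ip y).
suff : forall i, near0 (fun d => b i <= linform (g i) (p + d *: v)).
  move=> /near0_all; apply: near0_imp => d _ Hd; apply: bs => // i ip.
  by rewrite linformD linformZ actv // mulr0 addr0.
move=> i; have [ip|ip] := eqVneq (linform (g i) p) (b i).
  by exists 1 => // d _ _; rewrite linformD linformZ actv // mulr0 addr0 ip.
have : b i < linform (g i) p by rewrite lt_def ip sb.
move=> /(near0_affine_lt (linform (g i) v)); apply: near0_imp => d _ /ltW.
by rewrite linformD linformZ.
Qed.

(** Built one inequality at a time: at the midpoint of two points of [s], every
    inequality that is slack at one of them is slack. *)
Lemma poly_slack m (g : 'I_m -> 'rV[R]_n) (b : 'I_m -> R) s :
    s = [set x | forall i, b i <= linform (g i) x] -> s !=set0 ->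
  exists2 p, s p & forall i, linform (g i) p = b i ->
    forall x, s x -> linform (g i) x = b i.
Proof.
move=> sE [x0 sx0]; suff: forall r : seq 'I_m, exists2 p, s p &
    forall i, i \in r -> linform (g i) p = b i -> forall x, s x -> linform (g i) x = b i.
  by move=> /(_ (enum 'I_m))[p sp ip]; exists p => // i; apply: ip; rewrite mem_enum.
elim=> [|i r [p sp ip]]; first by exists x0.
have [sb|/existsNP[y /not_implyP[sy yi]]] :=
    pselect (forall x, s x -> linform (g i) x = b i).
  by exists p => // j; rewrite inE => /orP[/eqP->|/ip].
have mid j : linform (g j) (2^-1 *: (p + y)) = (linform (g j) p + linform (g j) y) / 2.
  by rewrite linformZ linformD mulrC.
have {}yi : b i < linform (g i) y.
  by rewrite lt_def; move: sy; rewrite sE => /(_ i) ->; rewrite andbT; apply/eqP.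
have sp' := sp; have sy' := sy; move: sp' sy'; rewrite {1 2}sE /= => pb yb.
exists (2^-1 *: (p + y)).
  by rewrite sE /= => j; rewrite mid; have := pb j; have := yb j; lra.
move=> j; rewrite inE => /orP[/eqP->|jr].
  by rewrite mid; have := pb i; lra.
rewrite mid => jb; apply: ip => //.
by have := pb j; have := yb j; lra.
Qed.

Lemma relint_exists s : rational_polyhedron s -> s !=set0 -> exists p, relint s p.
Proof.
move=> [m [g [b sE]]] s0; have [p sp act] := poly_slack sE s0.
exists p; apply: (@relint_active _ (fun i => toR R (g i)) b) => //.
- by move=> x i; rewrite sE; apply.
- by move=> x xb _; rewrite sE.
Qed.

End Polyhedra.

(** * Faces *)

Section Faces.
Context (R : realType) (n : nat).
Implicit Types (s t : set 'rV[R]_n) (a h p q v w x y : 'rV[R]_n) (c d : R).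

Lemma minlocus_sub a s : minlocus a s `<=` s. Proof. by move=> x []. Qed.

Lemma face_sub t s : face t s -> t `<=` s.
Proof. by move=> [_ [a ->]]; apply: minlocus_sub. Qed.

Lemma mem_minlocus a s p x : minlocus a s p ->
  minlocus a s x <-> s x /\ linform a x = linform a p.
Proof.
move=> [sp pmin]; split=> [[sx xmin]|[sx xp]].
  by split=> //; apply/eqP; rewrite eq_le pmin ?xmin.
by split=> // y sy; rewrite xp pmin.
Qed.

Lemma minlocus_Vspace a s v : v \in Vspace (minlocus a s) -> linform a v = 0.
Proof.
apply: Vspace_const => x y ax ay.
by have /(mem_minlocus _ ay)[] := ax.
Qed.

(** The face cut out by the sum of the inequalities that are active at [p]. *)
Lemma relint_face s p : rational_polyhedron s -> s p ->
  exists2 t, face t s & relint t p.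
Proof.
move=> [m [g [b sE]]] sp; pose G i := toR R (g i).
pose act : pred 'I_m := fun i => linform (G i) p == b i.
pose a := \sum_(i | act i) G i.
have sb x i : s x -> b i <= linform (G i) x by rewrite sE; apply.
have ap : minlocus a s p.
  split=> // y sy; rewrite /a !linform_suml; apply: ler_sum => i /eqP ->.
  exact: sb.
have aE x : minlocus a s x -> forall i, linform (G i) p = b i -> linform (G i) x = b i.
  move=> ax i /eqP ip; have [sx] := (mem_minlocus x ap).1 ax.
  rewrite /a !linform_suml => xp.
  have /psumr_eq0P : \sum_(i | act i) (linform (G i) x - b i) = 0.
    rewrite sumrB xp -sumrB big1 // => j /eqP ->; exact: subrr.
  move=> /(_ _ i ip) /eqP; rewrite subr_eq0 => /(_ _) /eqP; apply => j _.
  by rewrite subr_ge0 sb.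
exists (minlocus a s); first by split; [exists p|exists a].
apply: (@relint_active _ _ _ G b) => //.
- by move=> x i /minlocus_sub; apply: sb.
- move=> x xb xact; apply/(mem_minlocus _ ap); split; first by rewrite sE.
  by rewrite /a !linform_suml; apply: eq_bigr => i /eqP ip; rewrite ip xact.
- by move=> i ip x /aE ->.
Qed.

Lemma relint_minimum a s p : relint s p ->
  (forall x, s x -> linform a p <= linform a x) ->
  forall x, s x -> linform a x = linform a p.
Proof.
move=> [sp rp] pmin x sx; apply/eqP; rewrite eq_le pmin // andbT.
have /near0_ex[d d0 /pmin] := rp _ (Vspace_sub sp sx).
rewrite linformD linformZ linformB lerDl pmulr_rge0 //; lra.
Qed.

(** Minimality propagates from a relative interior point to the whole
    polyhedron. *)
Lemma relint_sub_face s' s t p : s' `<=` s -> face t s -> relint s' p -> t p ->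
  s' `<=` t.
Proof.
move=> ss [_ [a ->]] rp ap x s'x; apply/(mem_minlocus _ ap); split; first exact: ss.
by apply: (relint_minimum rp) => // y /ss; apply: ap.2.
Qed.

Lemma face_relint_eq t s p : face t s -> relint s p -> t p -> t = s.
Proof.
move=> ts rp tp; apply/seteqP; split; first exact: face_sub.
exact: (relint_sub_face _ ts rp tp).
Qed.

Lemma pdim_sub s t : s `<=` t -> (pdim s <= pdim t)%N.
Proof. by move=> /subset_Vspace /dimvS. Qed.

Lemma Vspace_eq_dim s t : s `<=` t -> (pdim t <= pdim s)%N -> Vspace s = Vspace t.
Proof. by move=> /subset_Vspace st ts; apply/eqP; rewrite eqEdim st. Qed.

Lemma face_dim_eq t s : face t s -> (pdim s <= pdim t)%N -> t = s.
Proof.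
move=> ts; have [[p tp] [a tE]] := ts => dts; apply/seteqP; split; first exact: face_sub.
move=> x sx; have tV := Vspace_eq_dim (face_sub ts) dts.
rewrite tE; rewrite tE in tp; apply/(mem_minlocus _ tp); split => //.
have : x - p \in Vspace t by rewrite tV; apply: Vspace_sub => //; case: tp.
by rewrite tE => /minlocus_Vspace /eqP; rewrite linformB subr_eq0 => /eqP.
Qed.

End Faces.
(** * Facets and lattice normals *)

Section Facets.
Context (R : realType) (n : nat).
Implicit Types (s t : set 'rV[R]_n) (a h p q v w x y : 'rV[R]_n) (c d : R).

Definition facet t s := face t s /\ (pdim t).+1 = pdim s.

Lemma facet_pt a s t : facet t s -> minlocus a s = t ->
  exists2 x, s x & forall p, t p -> linform a p < linform a x.
Proof.
move=> [ts dts] aE; have [x sx tx] : exists2 x, s x & ~ t x.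
  apply: contrapT => nx; have st : s `<=` t.
    by move=> x sx; apply: contrapT => tx; apply: nx; exists x.
  by have := pdim_sub st; rewrite -dts ltnn.
exists x => // p tp; rewrite lt_neqAle; apply/andP; split; last first.
  by move: tp; rewrite -aE => -[_ ->].
apply/eqP => px; apply: tx; rewrite -aE; apply/(mem_minlocus _ (_ : minlocus a s p)) => //.
by rewrite aE.
Qed.

Lemma facet_ker a s t v : facet t s -> minlocus a s = t ->
  v \in Vspace s -> linform a v = 0 -> v \in Vspace t.
Proof.
move=> ts aE vs v0; have [x sx tx] := facet_pt ts aE.
have [[[p tp] _] dts] := ts.
have sub : (Vspace t <= Vspace s :&: linker a)%VS.
  apply/subvP => w wt; rewrite memv_cap (subvP (subset_Vspace (face_sub ts.1))) //=.
  by rewrite mem_linker -(minlocus_Vspace (_ : w \in Vspace (minlocus a s))) // aE.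
suff /eqP -> : Vspace t == (Vspace s :&: linker a)%VS.
  by rewrite memv_cap vs mem_linker v0 eqxx.
rewrite eqEdim sub -ltnS -/(pdim t) dts ltnNge; apply/negP => le.
have /eqP VE : (Vspace s :&: linker a)%VS == Vspace s by rewrite eqEdim capvSl.
have : x - p \in Vspace s by apply: Vspace_sub => //; apply: (face_sub ts.1).
rewrite -VE memv_cap mem_linker linformB subr_eq0 => /andP[_ /eqP xp].
by have := tx p tp; rewrite xp ltxx.
Qed.

(** Along [s], a facet is described by one coordinate: modulo [Vspace t] every
    vector is a multiple of any fixed vector on which the form is nonzero. *)
Lemma facet_decomp a s t v w : facet t s -> minlocus a s = t ->
  v \in Vspace s -> w \in Vspace s -> linform a w != 0 ->
  (v - (linform a v / linform a w) *: w : 'rV[R]_n) \in Vspace t.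
Proof.
move=> ts aE vs ws w0; apply: (facet_ker ts aE).
  by rewrite rpredB // rpredZ.
by rewrite linformB linformZ divfK // subrr.
Qed.

(** On the span of [s], by [facet_decomp], such a form is a positive multiple of
    the form that defines the face. *)
Lemma facet_minlocus h s t p y : facet t s -> t p ->
  (forall v, v \in Vspace t -> linform h v = 0) ->
  s y -> linform h p < linform h y -> minlocus h s = t.
Proof.
move=> ts tp ht sy py; have [_ [a /esym aE]] := ts.1.
have st := face_sub ts.1; have sp := st _ tp.
have ap : minlocus a s p by rewrite aE.
have ay : 0 < linform a (y - p).
  rewrite linformB subr_gt0 lt_neqAle ap.2 // andbT; apply/eqP => pya.
  have ty : t y by rewrite -aE; apply/(mem_minlocus _ ap).
  have /ht/eqP := Vspace_sub ty tp; rewrite linformB subr_eq0.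
  by rewrite gt_eqF.
have hE z : s z -> linform h (z - p) =
    linform a (z - p) / linform a (y - p) * linform h (y - p).
  move=> sz; have := facet_decomp ts aE (Vspace_sub sz sp) (Vspace_sub sy sp).
  rewrite gt_eqF // => /(_ isT) /ht /eqP.
  by rewrite (linformB h (z - p)) linformZ subr_eq0 => /eqP.
have h0 : 0 < linform h (y - p) by rewrite linformB subr_gt0.
have hp : minlocus h s p.
  split=> // z sz; rewrite -subr_ge0 -linformB hE // mulr_ge0 ?(ltW h0) //.
  by rewrite divr_ge0 ?(ltW ay) // linformB subr_ge0 ap.2.
apply/seteqP; split=> z.
  move=> /(mem_minlocus _ hp)[sz /eqP]; rewrite -subr_eq0 -linformB hE //.
  rewrite !mulf_eq0 invr_eq0 (gt_eqF h0) (gt_eqF ay) !orbF linformB subr_eq0.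
  by move=> /eqP za; rewrite -aE; apply/(mem_minlocus _ ap).
move=> tz; apply/(mem_minlocus _ hp); split; first exact: st.
by apply/eqP; rewrite -subr_eq0 -linformB ht // Vspace_sub.
Qed.

(** The vector [v] is the sum of a positive multiple of a vector [x - p] pointing
    into [s] and of a vector along the facet. Each can be followed for a while
    inside [s], and convexity combines the two moves. *)
Lemma facet_germ a s t p v : rational_polyhedron s -> facet t s ->
  minlocus a s = t -> relint t p -> v \in Vspace s -> 0 < linform a v ->
  near0 (fun d => s (p + d *: v)).
Proof.
move=> Ps ts aE [tp rp] vs v0; have [x sx xt] := facet_pt ts aE.
have st := face_sub ts.1; have sp := st _ tp.
have ax : 0 < linform a (x - p) by rewrite linformB subr_gt0 xt.
pose c := linform a v / linform a (x - p).
have c0 : 0 < c by rewrite divr_gt0.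
have := facet_decomp ts aE vs (Vspace_sub sx sp).
rewrite gt_eqF // => /(_ isT) /rp /near0_ex[d d0 td].
pose e := Num.min d c^-1.
have e0 : 0 < e by rewrite lt_min d0 invr_gt0.
apply: (@poly_near0 _ _ _ _ _ (e / 2)) => //; first by rewrite divr_gt0.
have s1 : s (p + e *: (v - c *: (x - p))).
  by apply: (@poly_segment _ _ _ _ _ d) => //; [apply: st|rewrite (ltW e0) ge_min lexx].
have s2 : s (p + (e * c) *: (x - p)).
  apply: poly_convex => //; rewrite mulr_ge0 ?(ltW e0) ?(ltW c0) //=.
  by rewrite -ler_pdivlMr // div1r ge_min lexx orbT.
have := @poly_convex _ _ _ _ _ 2^-1 Ps s1 s2.
have -> : p + e *: (v - c *: (x - p)) + 2^-1 *: (p + e * c *: (x - p)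
    - (p + e *: (v - c *: (x - p)))) = p + (e / 2) *: v.
  by apply/rowP => j; rewrite !mxE; field.
by apply; lra.
Qed.

Lemma toRB (v w : 'rV[int]_n) : toR R (v - w) = toR R v - toR R w.
Proof. exact: map_mxB. Qed.

Lemma toRMz (v : 'rV[int]_n) k : toR R (v *~ k) = toR R v *~ k.
Proof. exact: raddfMz. Qed.

Lemma linformMz a v k : linform a (v *~ k) = linform a v *~ k.
Proof. by rewrite -scaler_int linformZ mulrzl. Qed.

Lemma linform_int (g v : 'rV[int]_n) :
  linform (toR R g) (toR R v) = (\sum_j g 0 j * v 0 j)%:~R.
Proof. by rewrite rmorph_sum; apply: eq_bigr => j _; rewrite !mxE rmorphM. Qed.

Lemma in_latticeB s (v w : 'rV[int]_n) :
  in_lattice s v -> in_lattice s w -> in_lattice s (v - w).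
Proof. by rewrite /in_lattice toRB; apply: rpredB. Qed.

Lemma in_latticeMz s (v : 'rV[int]_n) k : in_lattice s v -> in_lattice s (v *~ k).
Proof. by rewrite /in_lattice toRMz; apply: rpredMz. Qed.

(** The defining property of a lattice normal involves an integral form; any
    real form cutting out the facet induces the same orientation. *)
Lemma lattice_normal_gt0 h s t u : facet t s -> minlocus h s = t ->
  is_lattice_normal s t u -> 0 < linform h (toR R u).
Proof.
move=> ts hE [us _ [g gE gu]]; have [x sx hx] := facet_pt ts hE.
have [[[p tp] _] _] := ts; have sp := face_sub ts.1 tp.
have xs := Vspace_sub sx sp.
have h0 : 0 < linform h (x - p) by rewrite linformB subr_gt0 hx.
have g0 : 0 <= linform (toR R g) (x - p).
  by rewrite linformB subr_ge0; move: tp; rewrite -gE => -[_ ->].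
have := facet_decomp ts hE us xs; rewrite gt_eqF // => /(_ isT); rewrite -gE.
move=> /minlocus_Vspace/eqP; rewrite (linformB _ (toR R u)) linformZ subr_eq0 => /eqP gE'.
have := gu; rewrite gE' ltNge; apply: contraTT; rewrite -leNgt => hu.
by rewrite negbK mulr_le0_ge0 // mulr_le0_ge0 // invr_ge0 ltW.
Qed.

(** Each of two lattice normals is an integral multiple of the other modulo
    [Vspace t], so they differ by a sign, which a linear form detects. *)
Lemma lattice_normal_unit h s t s' t' u u' :
  Vspace s = Vspace s' -> Vspace t = Vspace t' ->
  is_lattice_normal s t u -> is_lattice_normal s' t' u' ->
  (forall v, v \in Vspace t -> linform h v = 0) ->
  0 < linform h (toR R u) -> linform h (toR R u') != 0 ->
  toR R u' - toR R u *~ (sgz (linform h (toR R u'))) \in Vspace t.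
Proof.
move=> Vs Vt [us gen _] [us' gen' _] ht hu hu'.
have [|k] := gen u'; first by rewrite /in_lattice Vs.
rewrite /in_lattice toRB toRMz => uk.
have [|l] := gen' u; first by rewrite /in_lattice -Vs.
rewrite /in_lattice toRB toRMz -Vt => ul.
have hk : linform h (toR R u') = linform h (toR R u) *~ k.
  by apply/eqP; rewrite -subr_eq0 -linformMz -linformB ht.
have hl : linform h (toR R u) = linform h (toR R u') *~ l.
  by apply/eqP; rewrite -subr_eq0 -linformMz -linformB ht.
have kl : k * l = 1.
  have : linform h (toR R u) *~ (k * l) = linform h (toR R u) *~ 1.
    by rewrite mulrzA -hk -hl.
  by move=> /mulrIz; apply; rewrite gt_eqF.
have kE : k = sgz k.
  have /eqP : absz (k * l) = 1%N by rewrite kl.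
  by rewrite abszM muln_eq1 => /andP[/eqP k1 _]; rewrite [LHS]intEsg k1 mulr1.
suff -> : sgz (linform h (toR R u')) = k by [].
rewrite hk -mulrzr sgzM sgz_int [in RHS]kE.
by rewrite gtr0_sgz // mul1r.
Qed.

Lemma row_clear_denominators (m : nat) (r : 'rV[rat]_m) :
  exists2 c : rat, c != 0 & exists z : 'rV[int]_m, c *: r = map_mx intr z.
Proof.
exists (\prod_j (denq (r 0 j))%:~R).
  by apply/prodf_neq0 => j _; rewrite intr_eq0 denq_neq0.
exists (\row_j (numq (r 0 j) * \prod_(k | k != j) denq (r 0 k))).
apply/rowP => j; rewrite !mxE (bigD1 j) //= mulrAC rmorphM rmorph_prod.
congr (_ * _); rewrite mulrC -{1}[r 0 j]divq_num_den divfK //.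
by rewrite intr_eq0 denq_neq0.
Qed.

(** The kernel of an integral matrix has a rational basis, hence an integral
    one after clearing denominators. *)
Lemma int_kernel_dense (m : nat) (G : 'M[int]_(n, m)) h :
    (forall v : 'rV[int]_n, v *m G = 0 -> linform h (toR R v) = 0) ->
  forall v : 'rV[R]_n, v *m map_mx intr G = 0 -> linform h v = 0.
Proof.
move=> hG v vG.
pose GQ : 'M[rat]_(n, m) := map_mx intr G.
have GE : map_mx (ratr : rat -> R) GQ = map_mx intr G.
  by rewrite -map_mx_comp; apply: eq_map_mx => x /=; rewrite ratr_int.
have linE w : linform h w = (w *m h^T) 0 0.
  by rewrite mxE; apply: eq_bigr => j _; rewrite mxE mulrC.
have hK i : linform h (map_mx ratr (row i (kermx GQ))) = 0.
  have [c c0 [z zE]] := row_clear_denominators (row i (kermx GQ)).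
  have zG : z *m G = 0.
    have : map_mx (intr : int -> rat) (z *m G) = 0.
      by rewrite map_mxM -zE -scalemxAl -row_mul mulmx_ker row0 scaler0.
    move=> /rowP zG0; apply/rowP => j; apply: (@intr_inj rat).
    by have := zG0 j; rewrite [LHS]mxE !mxE.
  have := hG z zG; have -> : toR R z = ratr c *: map_mx ratr (row i (kermx GQ)).
    rewrite -map_mxZ zE -map_mx_comp; apply: eq_map_mx => x /=.
    by rewrite ratr_int.
  by rewrite linformZ => /eqP; rewrite mulf_eq0 fmorph_eq0 (negPf c0) => /eqP.
have /sub_kermxP/submxP[w ->] := vG.
rewrite -GE -map_kermx mulmx_sum_row.
elim/big_rec: _ => [|i x _ IH]; first exact: linform0.
by rewrite linformD linformZ IH -map_row hK mulr0 addr0.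
Qed.

(** The span of [s] is the common kernel of the integral forms that are constant
    on [s] because their inequality is an equation there. *)
Lemma lattice_dense s h : rational_polyhedron s -> s !=set0 ->
    (forall v : 'rV[int]_n, in_lattice s v -> linform h (toR R v) = 0) ->
  forall v, v \in Vspace s -> linform h v = 0.
Proof.
move=> [m [g [b sE]]] s0 hs; have [p sp act] := poly_slack sE s0.
pose G : 'M[int]_(n, m) :=
  \matrix_(j, i) (if linform (toR R (g i)) p == b i then g i 0 j else 0).
have GE (v : 'rV[R]_n) i : (v *m map_mx intr G) 0 i =
    if linform (toR R (g i)) p == b i then linform (toR R (g i)) v else 0.
  rewrite mxE; case: ifP => ip.
    by apply: eq_bigr => j _; rewrite !mxE ip mulrC.
  by apply: big1 => j _; rewrite !mxE ip mulr0.
have VG v : v \in Vspace s -> v *m map_mx intr G = 0.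
  move=> vs; apply/rowP => i; rewrite GE [RHS]mxE; case: ifP => // /eqP ip.
  by apply: (Vspace_const _ vs) => x y sx sy; rewrite (act i ip x) // (act i ip y).
have GV v : v *m map_mx intr G = 0 -> v \in Vspace s.
  move=> vG; apply: (Vspace_germ sp); rewrite sE; apply: near0_all => i.
  have : (v *m map_mx intr G) 0 i = 0 by rewrite vG mxE.
  rewrite GE; have := sp; rewrite {1}sE => /(_ i); rewrite le_eqVlt eq_sym.
  case: eqP => [ip _ v0|_ /= ib _].
    by exists 1 => // d _ _; rewrite linformD linformZ v0 mulr0 addr0 ip.
  apply: near0_imp (near0_affine_lt (linform (toR R (g i)) v) ib) => d _ /ltW.
  by rewrite linformD linformZ.
move=> v /VG; apply: int_kernel_dense => z zG; apply: hs; apply: GV.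
by rewrite -map_mxM zG map_mx0.
Qed.

(** At a relative interior point of the facet some active inequality is not an
    equation on the polyhedron; it is integral and cuts out the facet. *)
Lemma facet_integral s t : rational_polyhedron s -> facet t s ->
  (exists p, relint t p) -> exists g : 'rV[int]_n, minlocus (toR R g) s = t.
Proof.
move=> [m [g [b sE]]] ts [p rp]; have tp := relint_in rp.
have sp := face_sub ts.1 tp.
have sb x i : s x -> b i <= linform (toR R (g i)) x by rewrite sE; apply.
have [act|/existsNP[i /not_implyP[ip /existsNP[y /not_implyP[sy yb]]]]] := pselect
    (forall i, linform (toR R (g i)) p = b i -> forall x, s x -> linform (toR R (g i)) x = b i).
  have rs : relint s p.
    apply: (@relint_active _ _ _ (fun i => toR R (g i)) b) => //.
    by move=> x xb _; rewrite sE.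
  by have := ts.2; rewrite (face_relint_eq ts.1 rs tp) => /eqP; rewrite gtn_eqF.
exists (g i); apply: (facet_minlocus ts tp _ sy).
  apply: Vspace_const.
  have tb x : t x -> linform (toR R (g i)) x = linform (toR R (g i)) p.
    apply: (relint_minimum rp) => z tz; rewrite ip; apply: sb.
    exact: (face_sub ts.1).
  by move=> x x' /tb -> /tb ->.
by rewrite ip lt_neqAle sb // andbT; apply/eqP => /esym.
Qed.

(** The generator is a lattice vector on which the integral form takes its
    least positive value; euclidean division by that value gives generation. *)
Lemma lattice_normal_exists s t : rational_polyhedron s -> facet t s ->
  (exists p, relint t p) -> exists u, is_lattice_normal s t u.
Proof.
move=> Ps ts rt; have [g gE] := facet_integral Ps ts rt.
pose G (v : 'rV[int]_n) : int := \sum_j g 0 j * v 0 j.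
have GE (v : 'rV[int]_n) : linform (toR R g) (toR R v) = (G v)%:~R by exact: linform_int.
have GB (v w : 'rV[int]_n) : G (v - w) = G v - G w.
  by apply: (@intr_inj R); rewrite -GE toRB linformB !GE rmorphB.
have GM (v : 'rV[int]_n) k : G (v *~ k) = G v * k.
  by apply: (@intr_inj R); rewrite -GE toRMz linformMz GE rmorphM mulrzr.
pose P k := `[< exists2 v : 'rV[int]_n, in_lattice s v & G v = k.+1%:Z >].
have exP : exists k, P k.
  have [v sv Gv] : exists2 v : 'rV[int]_n, in_lattice s v & G v != 0.
    apply: contrapT => noG; have [[p tp] _] := ts.1.
    have [x sx /(_ p tp)] := facet_pt ts gE; rewrite -subr_gt0 -linformB.
    rewrite (@lattice_dense s) ?ltxx //.
    - by exists x.
    - move=> v sv; rewrite GE; have [->//|Gv] := eqVneq (G v) 0.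
      by case: noG; exists v.
    - by apply: Vspace_sub => //; apply: (face_sub ts.1).
  have sN : in_lattice s (v *~ sgz (G v)) by apply: in_latticeMz.
  exists `|G v|%N.-1; apply/asboolP; exists (v *~ sgz (G v)) => //.
  by rewrite GM prednK ?absz_gt0 // {1}[G v]intEsg mulrAC mulz_sg Gv mul1r.
case: (ex_minnP exP) => k /asboolP[u su Gu] kmin.
exists u; split=> //; last by exists g; rewrite // GE Gu ltr0z.
move=> v sv; exists (G v %/ G u)%Z.
have sw : in_lattice s (v - u *~ (G v %/ G u)%Z).
  by apply: in_latticeB => //; apply: in_latticeMz.
apply: (facet_ker ts gE sw); rewrite GE.
set w := v - _ in sw *.
have Gw : G w = (G v %% G u)%Z by rewrite GB GM /modz mulrC.
have w0 : 0 <= G w by rewrite Gw modz_ge0 // Gu.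
have wu : G w < G u by rewrite Gw ltz_pmod // Gu.
case E: (G w) w0 wu => [[|j]|//] _ //; rewrite Gu ltz_nat ltnS => jk.
have /kmin : P j by apply/asboolP; exists w.
by rewrite leqNgt jk.
Qed.

Lemma lattice_normalP s t : rational_polyhedron s -> facet t s ->
  (exists p, relint t p) -> is_lattice_normal s t (lattice_normal s t).
Proof.
move=> Ps ts rt; apply: xgetPex; exact: lattice_normal_exists.
Qed.

Lemma facet_minlocus_sub h s t s' t' : facet t s -> facet t' s' ->
  s' `<=` s -> t' `<=` t -> Vspace t' = Vspace t ->
  minlocus h s = t -> minlocus h s' = t'.
Proof.
move=> ts ts' ss tt VE hE; have [[[p t'p] [a /esym aE]] _] := ts'.
have [x s'x xa] := facet_pt ts' aE; have tp := tt _ t'p.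
apply: (facet_minlocus ts' t'p _ s'x) => [v|].
  by rewrite VE -hE; apply: minlocus_Vspace.
have hp : minlocus h s p by rewrite hE.
rewrite lt_neqAle hp.2 ?andbT; last exact: ss.
apply/eqP => px; have := xa p t'p; rewrite -subr_gt0 -linformB.
have : x - p \in Vspace t.
  apply: (facet_ker ts hE); last by rewrite linformB px subrr.
  by apply: Vspace_sub; [apply: ss|apply: (face_sub ts.1)].
by rewrite -VE -aE => /minlocus_Vspace ->; rewrite ltxx.
Qed.

End Facets.
(** * Cells of a complex *)

Section Complexes.
Context (R : realType) (n d : nat).
Implicit Types (X : polyComplex R n d) (s t : set 'rV[R]_n).
Implicit Types (h p q v w x y : 'rV[R]_n).

Lemma cells_finite X : finite_set (cells X). Proof. by case: X. Qed.

Lemma cell_nonempty X s : cells X s -> s !=set0.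
Proof. by case: X => ? ? ? ? H *; case: (H s). Qed.

Lemma cell_poly X s : cells X s -> rational_polyhedron s.
Proof. by case: X => ? ? ? ? H *; case: (H s). Qed.

Lemma face_cell X s t : cells X s -> face t s -> cells X t.
Proof. by case: X => ? ? ? ? ? H ? ? ? ?; apply: H. Qed.

Lemma cell_cap_face X s t : cells X s -> cells X t -> s `&` t !=set0 ->
  face (s `&` t) s /\ face (s `&` t) t.
Proof. by case: X => ? ? ? ? ? ? H ? ? ?; apply: H. Qed.

Lemma mcell_inj X : injective (@mcell _ _ _ X). Proof. by case: X. Qed.

Lemma maximal_cellP X s : maximal_cell (cells X) s <-> exists i : 'I_(ncells X), mcell i = s.
Proof.
have <- : range (@mcell _ _ _ X) = maximal_cell (cells X) by case: X.
by split=> [[i _ <-]|[i <-]]; exists i.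
Qed.

Lemma mcell_cell X (i : 'I_(ncells X)) : cells X (mcell i).
Proof. by have [] : maximal_cell (cells X) (mcell i) by apply/maximal_cellP; exists i. Qed.

Lemma pdim_mcell X (i : 'I_(ncells X)) : pdim (mcell i) = d.
Proof.
have : maximal_cell (cells X) (mcell i) by apply/maximal_cellP; exists i.
by case: X i => ? ? ? ? ? ? ? H ? ? i; apply: H.
Qed.

Lemma mcell_poly X (i : 'I_(ncells X)) : rational_polyhedron (mcell i).
Proof. exact: cell_poly (mcell_cell i). Qed.

Lemma cell_relint X s : cells X s -> exists p, relint s p.
Proof. by move=> Xs; apply: relint_exists (cell_poly Xs) (cell_nonempty Xs). Qed.

Lemma subcell_face X s t : cells X s -> cells X t -> t `<=` s -> face t s.
Proof.
move=> Xs Xt ts; have tE : t `&` s = t by apply: setIidl.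
by have [|_] := @cell_cap_face X t s Xt Xs; rewrite tE //; apply: cell_nonempty Xt.
Qed.

Lemma relint_subcell X s t p : cells X s -> cells X t -> relint t p -> s p -> t `<=` s.
Proof.
move=> Xs Xt rp sp; have tp := relint_in rp.
have [|ts _] := @cell_cap_face X t s Xt Xs; first by exists p.
have <- : t `&` s = t by apply: face_relint_eq ts rp _.
exact: subIsetr.
Qed.

(** A cell of largest dimension among those containing [s]; since contained cells
    are faces, a strictly larger cell would have larger dimension. *)
Lemma cell_sub_mcell X s : cells X s -> exists i : 'I_(ncells X), s `<=` mcell i.
Proof.
move=> Xs; pose P k := `[< exists2 t, cells X t /\ s `<=` t & pdim t = k >].
have exP : exists k, P k by exists (pdim s); apply/asboolP; exists s => //; split.
have boundP k : P k -> (k <= \dim {:'rV[R]_n})%N.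
  by move=> /asboolP[t _ <-]; rewrite /pdim dimvS ?subvf.
case: (ex_maxnP exP boundP) => k /asboolP[t [Xt st] tk] kmax.
have : maximal_cell (cells X) t.
  split=> // t' Xt' tt'; apply/esym/(face_dim_eq (subcell_face Xt' Xt tt')).
  rewrite tk; apply: kmax; apply/asboolP; exists t' => //.
  by split=> //; apply: subset_trans tt'.
by move=> /maximal_cellP[i iE]; exists i; rewrite iE.
Qed.

Lemma pdim_cell X s : cells X s -> (pdim s <= d)%N.
Proof. by move=> /cell_sub_mcell[i /pdim_sub]; rewrite pdim_mcell. Qed.

Lemma cell_mcell X s (i : 'I_(ncells X)) :
  cells X s -> s `<=` mcell i -> (d <= pdim s)%N -> s = mcell i.
Proof.
move=> Xs si ds; apply: face_dim_eq; last by rewrite pdim_mcell.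
exact: subcell_face (mcell_cell i) Xs si.
Qed.

(** Faces of full dimension are not proper. *)
Lemma mcell_unique X (i j : 'I_(ncells X)) s : s !=set0 ->
  s `<=` mcell i -> s `<=` mcell j -> (d <= pdim s)%N -> i = j.
Proof.
move=> [p sp] si sj ds.
have [|fi fj] := @cell_cap_face X _ _ (mcell_cell i) (mcell_cell j).
  by exists p; split; [apply: si|apply: sj].
have dij : (d <= pdim (mcell i `&` mcell j))%N.
  by apply: leq_trans ds _; apply: pdim_sub => x sx; split; [apply: si|apply: sj].
apply: mcell_inj; rewrite -(face_dim_eq fi) ?pdim_mcell //.
by rewrite [LHS](face_dim_eq fj) ?pdim_mcell.
Qed.

(** The intersection of the two cells is a face of both; as it contains [t] and a
    point off the affine hull of [t], it has full dimension. *)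
Lemma mcell_facet_unique X (i j : 'I_(ncells X)) t p x : (pdim t).+1 = d ->
  t `<=` mcell i -> t `<=` mcell j -> t p -> mcell i x -> mcell j x ->
  x - p \notin Vspace t -> i = j.
Proof.
move=> dt ti tj tp ix jx xp; apply: (@mcell_unique _ _ _ (mcell i `&` mcell j)).
- by exists x.
- exact: subIsetl.
- exact: subIsetr.
have tij : t `<=` mcell i `&` mcell j by move=> y ty; split; [apply: ti|apply: tj].
have le := subset_Vspace tij.
suff : (pdim t < pdim (mcell i `&` mcell j))%N by rewrite dt.
rewrite ltn_neqAle (dimvS le) andbT; apply: contraNN xp => dE.
have -> : Vspace t = Vspace (mcell i `&` mcell j) by apply: Vspace_eq_dim tij _; rewrite (eqP dE).
by apply: Vspace_sub => //; apply: tij.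
Qed.

Lemma mcell_facet X (i : 'I_(ncells X)) t : cells X t -> (pdim t).+1 = d ->
  t `<=` mcell i -> facet t (mcell i).
Proof.
move=> Xt dt ti; split; last by rewrite pdim_mcell.
exact: subcell_face (mcell_cell i) Xt ti.
Qed.

(** Two maximal cells on the same side of a common facet share a germ leaving
    the facet. *)
Lemma mcell_side_unique X (i j : 'I_(ncells X)) t h : cells X t -> (pdim t).+1 = d ->
  Vspace (mcell i) = Vspace (mcell j) ->
  minlocus h (mcell i) = t -> minlocus h (mcell j) = t -> i = j.
Proof.
move=> Xt dt Vij hi hj; have [p rp] := cell_relint Xt; have tp := relint_in rp.
have ti : t `<=` mcell i by rewrite -hi; apply: minlocus_sub.
have tj : t `<=` mcell j by rewrite -hj; apply: minlocus_sub.
have fi := mcell_facet Xt dt ti; have fj := mcell_facet Xt dt tj.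
have [x ix xh] := facet_pt fi hi.
have h0 : 0 < linform h (x - p) by rewrite linformB subr_gt0 xh.
have Vi : x - p \in Vspace (mcell i) by apply: Vspace_sub => //; apply: ti.
have Vj : x - p \in Vspace (mcell j) by rewrite -Vij.
have gi := facet_germ (mcell_poly i) fi hi rp Vi h0.
have gj := facet_germ (mcell_poly j) fj hj rp Vj h0.
have [e e0 [ie je]] := near0_ex (near0_and gi gj).
apply: (mcell_facet_unique dt ti tj tp ie je).
rewrite addrC addKr rpredZeq gt_eqF //=; apply/negP; rewrite -{1}hi.
by move=> /minlocus_Vspace h00; rewrite h00 ltxx in h0.
Qed.

Lemma support_relint X p : Defs.support X p -> exists2 t, cells X t & relint t p.
Proof.
move=> [s Xs sp]; have [t ts rp] := relint_face (cell_poly Xs) sp.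
by exists t => //; apply: face_cell ts.
Qed.

Lemma support_mcell X p : Defs.support X p -> exists i : 'I_(ncells X), mcell i p.
Proof.
by move=> [s Xs sp]; have [i si] := cell_sub_mcell Xs; exists i; apply: si.
Qed.

Lemma mcell_germ X p v : near0 (fun c => Defs.support X (p + c *: v)) ->
  exists i : 'I_(ncells X), near0 (fun c => mcell i (p + c *: v)).
Proof.
move=> nX; apply: near0_pigeonhole => [i|]; first exact: poly_germ (mcell_poly i).
by apply: near0_imp nX => c _; apply: support_mcell.
Qed.

End Complexes.

(** * General position *)

Section Generic.
Context (R : realType) (n : nat).
Implicit Types (s t : set 'rV[R]_n) (h p q v w x y : 'rV[R]_n).

(** The line through [p] along [v] is not contained in the affine subspace
    [q + U], hence meets it at most once. *)
Lemma near0_avoid p q v (U : {vspace 'rV[R]_n}) : p - q \notin U \/ v \notin U ->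
  near0 (fun c => p + c *: v - q \notin U).
Proof.
have move_out c e : c != e -> p + c *: v - q \in U -> p + e *: v - q \in U -> v \in U.
  move=> ce pc pe; have := rpredB pc pe.
  have -> : p + c *: v - q - (p + e *: v - q) = (c - e) *: v.
    by apply/rowP => j; rewrite !mxE; ring.
  by rewrite rpredZeq subr_eq0 (negPf ce).
have [pU|pU] := boolP (p - q \in U) => [[//|vU]|_].
  exists 1 => // c c0 _; apply: contra vU => pc.
  by apply: (move_out c 0) => //; rewrite ?gt_eqF ?scale0r ?addr0.
have [[e [e0 pe]]|no] := pselect (exists e, 0 < e /\ p + e *: v - q \in U).
  exists (e / 2); first by rewrite divr_gt0.
  move=> c c0 ce; apply: contra pU => pc.
  have vU : v \in U by apply: (move_out c e) => //; rewrite lt_eqF //; lra.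
  have -> : p - q = p + e *: v - q - e *: v by apply/rowP => j; rewrite !mxE; ring.
  by rewrite rpredB // rpredZ.
by exists 1 => // c c0 _; apply/negP => pc; apply: no; exists c.
Qed.

(** By induction on the family: a small move along a direction of [s] outside
    the next subspace leaves it, without entering those already avoided. *)
Lemma relint_generic s (F : seq ('rV[R]_n * {vspace 'rV[R]_n})) :
  rational_polyhedron s -> s !=set0 ->
  (forall f, f \in F -> ~~ (Vspace s <= f.2)%VS) ->
  exists2 p, relint s p & forall f, f \in F -> p - f.1 \notin f.2.
Proof.
move=> Ps s0; elim: F => [|f F IH] sF.
  by have [p rp] := relint_exists Ps s0; exists p.
have [|p rp pF] := IH; first by move=> g gF; apply: sF; rewrite inE gF orbT.
have /subvPn[v vs vf] := sF f (mem_head _ _).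
have nF : near0 (fun c => forall g, g \in F -> p + c *: v - g.1 \notin g.2).
  elim: F {IH sF} pF => [|g F IH] pF; first by exists 1.
  have ng := @near0_avoid p g.1 v g.2 (or_introl (pF g (mem_head _ _))).
  have {}IH := IH (fun g' g'F => pF g' (mem_behead (s := g :: F) g'F)).
  apply: near0_imp (near0_and ng IH) => c _ [Hg HF] g'.
  by rewrite inE => /orP[/eqP->|/HF].
have [c c0 [[Hs Hf] HF]] := near0_ex
  (near0_and (near0_and (relint_move Ps rp vs) (@near0_avoid p f.1 v f.2 (or_intror vf))) nF).
exists (p + c *: v) => // g; rewrite inE => /orP[/eqP->//|]; exact: HF.
Qed.

Lemma relint_generic_family s (A : set (set 'rV[R]_n)) (q : set 'rV[R]_n -> 'rV[R]_n)
    (U : set 'rV[R]_n -> {vspace 'rV[R]_n}) :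
  rational_polyhedron s -> s !=set0 -> finite_set A ->
  exists2 p, relint s p &
    forall t, A t -> ~~ (Vspace s <= U t)%VS -> p - q t \notin U t.
Proof.
move=> Ps s0 /finite_seqP[r ->].
pose F := [seq (q t, U t) | t <- r & ~~ (Vspace s <= U t)%VS].
have [f /mapP[t]|p rp pF] := @relint_generic s F Ps s0.
  by rewrite mem_filter => /andP[tU _] -> /=.
exists p => // t /= tr tU; apply: (pF (q t, U t)); apply/mapP; exists t => //.
by rewrite mem_filter tU.
Qed.

(** Connectedness of a segment covered by polyhedra of two kinds. The crossing is
    at the supremum of the parameters covered by the first kind: polyhedra are
    closed, so this point lies in one of the first kind, and if it is not the
    endpoint, the germ of the segment to its right lies in one of the second. *)
Lemma segment_crossing (I : finType) (S : I -> set 'rV[R]_n) (Q : I -> Prop) p v i0 i1 :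
    (forall i, rational_polyhedron (S i)) ->
    (forall c, 0 <= c <= 1 -> exists i, S i (p + c *: v)) ->
    Q i0 -> S i0 p -> ~ Q i1 -> S i1 (p + v) ->
  exists c i i', [/\ 0 <= c <= 1, Q i, ~ Q i', S i (p + c *: v) & S i' (p + c *: v)].
Proof.
move=> PS cov Qi0 Sp Qi1 Sv.
pose E := [set c : R | 0 <= c <= 1 /\ exists2 i, Q i & S i (p + c *: v)].
have E0 : E 0 by split; [rewrite lexx ler01|exists i0; rewrite // scale0r addr0].
have ubE : ubound E 1 by move=> c [/andP[]].
have supE : has_sup E by split; [exists 0|exists 1].
pose m := sup E.
have m0 : 0 <= m by apply: ub_le_sup => //; exists 1.
have m1 : m <= 1 by apply: ge_sup => //; exists 0.
have [i Qi Si] : exists2 i, Q i & S i (p + m *: v).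
  apply: contrapT => nE.
  have /near0_all [e e0 nS] : forall i, near0 (fun c => Q i -> ~ S i (p + m *: v + c *: - v)).
    move=> i; have [Qi|nQi] := pselect (Q i); last by exists 1.
    have [/(poly_closed (PS i)) Si|] := poly_germ (p + m *: v) (- v) (PS i).
      by case: nE; exists i.
    exact: near0_imp.
  have [c [c01 [i Qi Si]] mc] := sup_adherent e0 supE.
  have cm : c <= m by apply: ub_le_sup; [exists 1|split=> //; exists i].
  have {}cm : c < m.
    by rewrite lt_neqAle cm andbT; apply/eqP => cm'; apply: nE; exists i; rewrite -?cm'.
  apply: (nS (m - c) _ _ i Qi); first by rewrite subr_gt0.
    by rewrite -/m in mc; lra.
  suff -> : p + m *: v + (m - c) *: - v = p + c *: v by [].
  by apply/rowP => j; rewrite !mxE; ring.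
have [m1'|m1'] := leP 1 m.
  have {}m1 : m = 1 by apply/le_anti; rewrite m1.
  exists m, i, i1; split=> //; first by rewrite m0 m1 lexx.
  by rewrite m1 scale1r.
have [||i' nS] := @near0_pigeonhole R I (fun i c => ~ Q i /\ S i (p + m *: v + c *: v)).
- move=> i'; have [Qi'|nQi'] := pselect (Q i'); first by right; exists 1 => // c _ _ [].
  have [nS|nS] := poly_germ (p + m *: v) v (PS i'); [left|right].
    exact: near0_imp nS.
  by apply: near0_imp nS => c _ nSc [_ /nSc].
- exists (1 - m); first by rewrite subr_gt0.
  move=> c c0 cm; have mc : 0 <= m + c <= 1 by apply/andP; split; lra.
  have [i' Si'] := cov _ mc; exists i'; split; last by rewrite -addrA -scalerDl.
  move=> Qi'; have : m + c <= m by apply: ub_le_sup; [exists 1|split=> //; exists i'].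
  lra.
exists m, i, i'; split=> //; first by rewrite m0.
  by have /near0_ex[c _ []] := nS.
by apply: (@poly_closed _ _ _ _ v (PS i')); apply: near0_imp nS => c _ [].
Qed.

End Generic.
(** * Balancing across a refinement *)

Section Refinement.
Context (R : realType) (n d : nat).
Implicit Types (h p q v x y : 'rV[R]_n).

Definition balancing_sum (X : polyComplex R n d) (w : 'rV[int]_(ncells X))
    (t : set 'rV[R]_n) : 'rV[R]_n :=
  \sum_(i | `[< face t (mcell i) >]) toR R (lattice_normal (mcell i) t) *~ w 0 i.

Context (X Y : polyComplex R n d) (YX : refines Y X).
Context (parent : 'I_(ncells Y) -> 'I_(ncells X)).
Context (sub_parent : forall i, mcell i `<=` mcell (parent i)).

Lemma parent_Vspace i : Vspace (mcell i) = Vspace (mcell (parent i)).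
Proof. by apply: Vspace_eq_dim => //; rewrite !pdim_mcell. Qed.

(** The relative interior of a maximal cell meets no other maximal cell, so
    near its points the refinement is a subdivision of that cell alone. *)
Lemma parent_relint p i j : relint (mcell j) p -> mcell i p -> parent i = j.
Proof.
move=> rp ip; have ji := relint_subcell (mcell_cell (parent i)) (mcell_cell j) rp (sub_parent ip).
apply: (@mcell_unique _ _ _ _ _ _ (mcell j)) => //; last by rewrite pdim_mcell.
by exists p; apply: relint_in rp.
Qed.

Lemma parent_surj j : exists i, parent i = j.
Proof.
have [p rp] := cell_relint (mcell_cell j).
have /support_mcell[i ip] : Defs.support Y p.
  by rewrite YX.1; exists (mcell j); [apply: mcell_cell|apply: relint_in rp].
by exists i; apply: parent_relint ip.
Qed.

Lemma refined_cell_sub t' t p : cells Y t' -> cells X t -> relint t' p ->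
  relint t p -> t' `<=` t.
Proof.
move=> Yt' Xt rp' rp; have [s Xs t's] := YX.2 _ Yt'.
have ts := relint_subcell Xs Xt rp (t's _ (relint_in rp')).
exact: relint_sub_face t's (subcell_face Xs Xt ts) rp' (relint_in rp).
Qed.

(** Around a wall of the coarse complex both complexes look alike: the maximal
    cells through [t'] lie one in each maximal cell through [t], with the same
    lattice normals. *)
Lemma wall_balancing_sum t' t p (w : 'rV[int]_(ncells X)) :
    cells Y t' -> cells X t -> (pdim t').+1 = d -> (pdim t).+1 = d ->
    relint t' p -> relint t p ->
  (balancing_sum (\row_i w 0 (parent i)) t' \in Vspace t') =
  (balancing_sum w t \in Vspace t).
Proof.
move=> Yt' Xt dt' dt rp' rp.
have t't := refined_cell_sub Yt' Xt rp' rp.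
have VE : Vspace t' = Vspace t.
  by apply: Vspace_eq_dim => //; rewrite -ltnS dt' -dt.
have tp := relint_in rp; have t'p := relint_in rp'.
have fX (j : 'I_(ncells X)) : mcell j p -> facet t (mcell j).
  by move=> jp; apply: mcell_facet => //; apply: relint_subcell (mcell_cell j) Xt rp jp.
have fY (i : 'I_(ncells Y)) : mcell i p -> facet t' (mcell i).
  by move=> ip; apply: mcell_facet => //; apply: relint_subcell (mcell_cell i) Yt' rp' ip.
have pX (j : 'I_(ncells X)) : face t (mcell j) -> mcell j p by move=> /face_sub; apply.
have pY (i : 'I_(ncells Y)) : face t' (mcell i) -> mcell i p by move=> /face_sub; apply.
have hXY h i : mcell i p -> minlocus h (mcell (parent i)) = t -> minlocus h (mcell i) = t'.
  move=> ip; apply: facet_minlocus_sub => //; first exact: fX (sub_parent ip).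
  exact: fY.
have nXY i : mcell i p -> toR R (lattice_normal (mcell i) t')
    - toR R (lattice_normal (mcell (parent i)) t) \in Vspace t.
  move=> ip; have jp := sub_parent ip.
  have [_ [h /esym hj]] := (fX _ jp).1; have hi := hXY h i ip hj.
  have Ni := lattice_normalP (mcell_poly i) (fY i ip) (ex_intro _ p rp').
  have Nj := lattice_normalP (mcell_poly _) (fX _ jp) (ex_intro _ p rp).
  have hgi := lattice_normal_gt0 (fY i ip) hi Ni.
  have hgj := lattice_normal_gt0 (fX _ jp) hj Nj.
  have := lattice_normal_unit (esym (parent_Vspace i)) (esym VE) Nj Ni _ hgj (lt0r_neq0 hgi).
  rewrite gtr0_sgz // mulr1z; apply => v; rewrite -hj; exact: minlocus_Vspace.
have part : forall i : 'I_(ncells Y), `[< face t' (mcell i) >] -> `[< face t (mcell (parent i)) >].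
  by move=> i /asboolP/pY/sub_parent/fX[? _]; apply/asboolP.
have fiber (j : 'I_(ncells X)) : face t (mcell j) -> exists i0,
    (fun i => `[< face t' (mcell i) >] && (parent i == j)) =1 pred1 i0.
  move=> tj; have jp := pX _ tj; have [_ [h /esym hj]] := tj.
  have [x jx xh] := facet_pt (fX _ jp) hj.
  have xp : x - p \notin Vspace t.
    apply/negP; rewrite -hj => /minlocus_Vspace/eqP.
    by rewrite linformB subr_eq0 gt_eqF // xh.
  have germX : near0 (fun c => mcell j (p + c *: (x - p))).
    by apply: (poly_near0 (mcell_poly j) jp ltr01); rewrite scale1r addrC subrK.
  have [|i0 ni0] := @mcell_germ _ _ _ Y p (x - p).
    by apply: near0_imp germX => c _ jc; rewrite YX.1; exists (mcell j) => //; apply: mcell_cell.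
  have i0p := poly_closed (mcell_poly i0) ni0.
  have [c c0 [i0c jc]] := near0_ex (near0_and ni0 germX).
  have i0j : parent i0 = j.
    apply: (mcell_facet_unique dt (face_sub (fX _ (sub_parent i0p)).1) (face_sub tj) tp
      (sub_parent i0c) jc).
    by rewrite addrC addKr rpredZeq gt_eqF.
  exists i0 => i /=; apply/andP/eqP => [[/asboolP/pY ip /eqP ij]|->]; last first.
    by split; [apply/asboolP; case: (fY _ i0p)|rewrite i0j].
  have hi : minlocus h (mcell i) = t' by apply: hXY; rewrite // ij.
  have hi0 : minlocus h (mcell i0) = t' by apply: hXY; rewrite // i0j.
  by apply: (mcell_side_unique Yt' dt' _ hi hi0); rewrite !parent_Vspace ij i0j.
have sumV : balancing_sum (\row_i w 0 (parent i)) t' - balancing_sum w t \in Vspace t.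
  rewrite /balancing_sum (partition_big parent (fun j => `[< face t (mcell j) >])) //= -sumrB.
  apply: rpred_sum => j /asboolP tj; have [i0 i0E] := fiber j tj.
  have := i0E i0; rewrite /= eqxx => /andP[/asboolP/pY i0p /eqP i0j].
  rewrite (big_pred1 i0) // mxE i0j -mulrzBl.
  by apply: rpredMz; have := nXY i0 i0p; rewrite i0j.
by rewrite VE -(subrK (balancing_sum w t) (balancing_sum (\row_i w 0 (parent i)) t')) rpredDl.
Qed.

(** Across a wall interior to a maximal cell [j] there are exactly two maximal
    cells, with opposite lattice normals, so balancing says that their weights
    agree. *)
Lemma interior_balancing_sum t' p (j : 'I_(ncells X)) (w : 'rV[int]_(ncells Y)) :
    cells Y t' -> (pdim t').+1 = d -> relint t' p -> relint (mcell j) p ->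
  balancing_sum w t' \in Vspace t' <->
  (forall i i', mcell i p -> mcell i' p -> w 0 i = w 0 i').
Proof.
move=> Yt' dt' rp' rp; have t'p := relint_in rp'.
have fY (i : 'I_(ncells Y)) : mcell i p -> facet t' (mcell i).
  by move=> ip; apply: mcell_facet => //; apply: relint_subcell (mcell_cell i) Yt' rp' ip.
have pY (i : 'I_(ncells Y)) : face t' (mcell i) -> mcell i p by move=> /face_sub; apply.
have VY (i : 'I_(ncells Y)) : mcell i p -> Vspace (mcell i) = Vspace (mcell j).
  by move=> ip; rewrite parent_Vspace (parent_relint rp ip).
have [i0 i0p] : exists i0 : 'I_(ncells Y), mcell i0 p.
  by have [i0 ti0] := cell_sub_mcell Yt'; exists i0; apply: ti0.
have [_ [h /esym h0]] := (fY _ i0p).1.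
have ht v : v \in Vspace t' -> linform h v = 0.
  by rewrite -h0; apply: minlocus_Vspace.
have [x xi0 /(_ p t'p) hx] := facet_pt (fY _ i0p) h0.
(* the cell on the other side contains the germ of the opposite direction *)
have xj : x - p \in Vspace (mcell j) by rewrite -(VY i0) // Vspace_sub.
have [|i1 ni1] := @mcell_germ _ _ _ Y p (- (x - p)).
  apply: near0_imp (rp.2 _ (_ : - (x - p) \in _)); last by rewrite rpredN.
  by move=> c _ jc; rewrite YX.1; exists (mcell j) => //; apply: mcell_cell.
have i1p := poly_closed (mcell_poly i1) ni1.
have htN v : v \in Vspace t' -> linform (- h) v = 0.
  by move=> vt; rewrite linformNl ht ?oppr0.
have h1 : minlocus (- h) (mcell i1) = t'.
  have [c c0 i1c] := near0_ex ni1; apply: (facet_minlocus (fY _ i1p) t'p htN i1c).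
  rewrite linformD ltrDl linformZ linformNl linformN opprK linformB.
  by rewrite mulr_gt0 // subr_gt0.
have i01 : i0 != i1.
  apply: contraTneq hx => i01; rewrite -leNgt.
  have : minlocus (- h) (mcell i0) p by rewrite i01 h1.
  by move=> [_ /(_ x xi0)]; rewrite !linformNl lerN2.
have only i : mcell i p -> i = i0 \/ i = i1.
  move=> ip; have [_ [a /esym ha]] := (fY _ ip).1.
  have [y yi /(_ p t'p) ay] := facet_pt (fY _ ip) ha.
  have [hy|hy|hy] := ltgtP (linform h p) (linform h y).
  - left; apply: (mcell_side_unique Yt' dt' _ _ h0); first by rewrite !VY.
    exact: (facet_minlocus (fY _ ip) t'p ht yi hy).
  - right; apply: (mcell_side_unique Yt' dt' _ _ h1); first by rewrite !VY.
    by apply: (facet_minlocus (fY _ ip) t'p htN yi); rewrite !linformNl ltrN2.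
  - have : y - p \in Vspace t'.
      apply: (facet_ker (fY _ i0p) h0); last by rewrite linformB hy subrr.
      by rewrite VY // -(VY i) // Vspace_sub.
    rewrite -ha => /minlocus_Vspace/eqP; rewrite linformB subr_eq0 => /eqP ay'.
    by rewrite ay' ltxx in ay.
pose u0 := toR R (lattice_normal (mcell i0) t').
pose u1 := toR R (lattice_normal (mcell i1) t').
have N0 := lattice_normalP (mcell_poly i0) (fY _ i0p) (ex_intro _ p rp').
have N1 := lattice_normalP (mcell_poly i1) (fY _ i1p) (ex_intro _ p rp').
have hu0 : 0 < linform h u0 := lattice_normal_gt0 (fY _ i0p) h0 N0.
have hu1 : linform h u1 < 0.
  by have := lattice_normal_gt0 (fY _ i1p) h1 N1; rewrite linformNl oppr_gt0.
have u01 : u1 + u0 \in Vspace t'.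
  have V01 : Vspace (mcell i0) = Vspace (mcell i1) by rewrite !VY.
  have := lattice_normal_unit V01 erefl N0 N1 ht hu0 (ltr0_neq0 hu1).
  by rewrite ltr0_sgz // mulrN1z opprK.
have -> : balancing_sum w t' = u0 *~ (w 0 i0 - w 0 i1) + (u1 + u0) *~ w 0 i1.
  rewrite /balancing_sum (bigD1 i0) /=; last by apply/asboolP; case: (fY _ i0p).
  rewrite (big_pred1 i1) => [|i /=].
    by rewrite mulrzBr mulrzDl -/u0 -/u1 [u1 *~ _ + u0 *~ _]addrC addrA subrK.
  apply/andP/eqP => [[/asboolP/pY/only[->|//]]|->]; first by rewrite eqxx.
  by split; [apply/asboolP; case: (fY _ i1p)|rewrite eq_sym].
rewrite rpredDr; last exact: rpredMz.
rewrite -scaler_int rpredZeq intr_eq0 subr_eq0.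
have -> : u0 \in Vspace t' = false.
  by apply/negP => /ht u00; rewrite u00 ltxx in hu0.
rewrite orbF; split=> [/eqP w01 i i' /only[]-> /only[]->//|wp].
by apply/eqP/wp.
Qed.


Lemma balanced_pullback (w : 'rV[int]_(ncells X)) :
  balanced w -> balanced (\row_i w 0 (parent i)).
Proof.
move=> bw t' Yt' dt'; have [p rp'] := cell_relint Yt'.
have [t Xt rp] : exists2 t, cells X t & relint t p.
  by apply: support_relint; rewrite -YX.1; exists t' => //; apply: relint_in rp'.
have t't := refined_cell_sub Yt' Xt rp' rp.
have := pdim_cell Xt; rewrite leq_eqVlt => /orP[/eqP td|td].
  have [j tj] := cell_sub_mcell Xt.
  have tE : t = mcell j by apply: cell_mcell; rewrite ?td.
  rewrite tE in rp; apply/(interior_balancing_sum _ Yt' dt' rp' rp) => i i' ip ip'.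
  by rewrite !mxE !(parent_relint rp).
have dt : (pdim t).+1 = d.
  by apply/eqP; rewrite eqn_leq td -{1}dt' ltnS pdim_sub.
rewrite -/(balancing_sum _ _) (wall_balancing_sum w Yt' Xt dt' dt rp' rp).
exact: bw.
Qed.

(** Connectedness in codimension one of a subdivided cell. A segment in general
    position between two maximal cells meets no cell of codimension two, so
    where the weight changes along it, it changes across a wall. *)
Lemma balanced_constant (w : 'rV[int]_(ncells Y)) i1 i2 :
  balanced w -> parent i1 = parent i2 -> w 0 i1 = w 0 i2.
Proof.
move=> bw p12; pose j := parent i1.
have sub i : parent i = j -> mcell i `<=` mcell j by move=> <-; apply: sub_parent.
have relint_sub i p : parent i = j -> relint (mcell i) p -> relint (mcell j) p.
  move=> ij [ip rp]; split=> [|v]; first exact: sub ip.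
  rewrite -ij -parent_Vspace => /rp; apply: near0_imp => c _; rewrite ij; exact: sub.
have [p1 rp1] := cell_relint (mcell_cell i1).
pose q (s : set 'rV[R]_n) : 'rV[R]_n := xget 0 s.
(* [p1 + U s] is the affine hull of [p1] and [s]; [p2] outside it keeps the
   segment from meeting [s] *)
pose U s := (Vspace s + <[q s - p1]>)%VS.
have [p2 rp2 gen] := relint_generic_family (fun=> p1) U (mcell_poly i2)
  (cell_nonempty (mcell_cell i2)) (cells_finite Y).
have rj1 := relint_sub i1 p1 erefl rp1; have rj2 := relint_sub i2 p2 (esym p12) rp2.
have rj c : 0 <= c <= 1 -> relint (mcell j) (p1 + c *: (p2 - p1)).
  move=> /andP[c0]; rewrite le_eqVlt => /orP[/eqP->|c1].
    by rewrite scale1r addrC subrK.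
  by apply: relint_segment (mcell_poly j) rj1 (relint_in rj2) _; rewrite c0.
apply: contrapT => w12.
have [|||||c [i [i' [c01 wi wi' xi xi']]]] := @segment_crossing R n _ (@mcell _ _ _ Y)
    (fun i => w 0 i = w 0 i1) p1 (p2 - p1) i1 i2 (@mcell_poly _ _ _ Y).
- move=> c /rj/relint_in jc; apply: support_mcell; rewrite YX.1.
  by exists (mcell j) => //; apply: mcell_cell.
- by [].
- exact: relint_in rp1.
- by move=> w21; apply: w12.
- by rewrite addrC subrK; apply: relint_in rp2.
have {}rj := rj c c01; set x := p1 + _ in rj xi xi'.
have [t' Yt' rx] : exists2 t', cells Y t' & relint t' x.
  by apply: support_relint; exists (mcell i) => //; apply: mcell_cell.
have t'i := relint_subcell (mcell_cell i) Yt' rx xi.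
have t'i' := relint_subcell (mcell_cell i') Yt' rx xi'.
have dt' : (pdim t' < d)%N.
  rewrite ltnNge; apply/negP => dt'; apply: wi'; rewrite -wi.
  by rewrite (mcell_unique (cell_nonempty Yt') t'i t'i').
have dt'' : (pdim t').+1 = d.
  apply/eqP; rewrite eqn_leq dt' leqNgt; apply/negP => dt''.
  have t'q : t' (q t').
    by have [y t'y] := cell_nonempty Yt'; apply: (@xgetPex _ 0 t'); exists y.
  have : p2 - p1 \notin U t'.
    apply: gen => //; apply/negP => /dimvS; rewrite -/(pdim _) pdim_mcell leqNgt.
    apply/negP; rewrite negbK; apply: leq_ltn_trans dt''.
    rewrite -[(pdim t').+1]addn1; apply: leq_trans (dimv_add_leqif _ _) _.
    by rewrite leq_add2l dim_vline leq_b1.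
  have c0 : c != 0.
    apply/eqP => c0; have x1 : x = p1 by rewrite /x c0 scale0r addr0.
    have /pdim_sub : mcell i1 `<=` t'.
      apply: relint_subcell Yt' (mcell_cell i1) rp1 _.
      by rewrite -x1; apply: relint_in rx.
    by rewrite pdim_mcell leqNgt dt'.
  have -> : p2 - p1 = c^-1 *: ((x - q t') + (q t' - p1)).
    have -> : x - q t' + (q t' - p1) = c *: (p2 - p1).
      by apply/rowP => k; rewrite !mxE; ring.
    by rewrite scalerA mulVf // scale1r.
  move=> /negP; apply; apply: rpredZ; apply: memv_add; last exact: memv_line.
  by apply: Vspace_sub => //; apply: relint_in rx.
apply: wi'; rewrite -wi; apply/esym.
exact: (interior_balancing_sum w Yt' dt'' rx rj).1 (bw t' Yt' dt'') i i' xi xi'.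
Qed.

(** Off the affine hulls of the finitely many fine cells whose span does not
    contain that of [t], the fine cell around a point of [t] has the dimension of
    [t]. *)
Lemma refined_wall t : cells X t ->
  exists t' p, [/\ cells Y t', pdim t' = pdim t, relint t' p & relint t p].
Proof.
move=> Xt; pose q (s : set 'rV[R]_n) : 'rV[R]_n := xget 0 s.
have [p rp gen] := relint_generic_family q (@Vspace R n) (cell_poly Xt)
  (cell_nonempty Xt) (cells_finite Y).
have [t' Yt' rp'] : exists2 t', cells Y t' & relint t' p.
  by apply: support_relint; rewrite YX.1; exists t => //; apply: relint_in rp.
exists t', p; split=> //; apply/eqP; rewrite eqn_leq.
rewrite (pdim_sub (refined_cell_sub Yt' Xt rp' rp)) /=; apply: dimvS.
apply/negPn/negP => /(gen t' Yt')/negP; apply.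
have t'q : t' (q t') by apply: (@xgetPex _ 0 t'); exists p; apply: relint_in rp'.
by apply: Vspace_sub => //; apply: relint_in rp'.
Qed.

(** A weight that is constant on the cells with a given parent is the pull-back
    of its values at arbitrarily chosen ones. *)
Lemma balanced_descent (w' : 'rV[int]_(ncells Y)) : balanced w' ->
  exists2 w : 'rV[int]_(ncells X), balanced w & w' = \row_i w 0 (parent i).
Proof.
move=> bw'; have [child childK] := fin_all_exists parent_surj.
exists (\row_j w' 0 (child j)); last first.
  by apply/rowP => i; rewrite !mxE; apply: balanced_constant; rewrite ?childK.
move=> t Xt dt; have [t' [p [Yt' dd rp' rp]]] := refined_wall Xt.
rewrite -/(balancing_sum _ _) -(wall_balancing_sum _ Yt' Xt _ dt rp' rp) ?dd //.
suff -> : \row_i (\row_j w' 0 (child j)) 0 (parent i) = w'.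
  by apply: bw' => //; rewrite dd.
by apply/rowP => i; rewrite !mxE; apply: balanced_constant; rewrite ?childK.
Qed.

End Refinement.

(** * Isomorphisms of weight spaces *)

Import VectorInternalTheory.

Section Isomorphisms.

Lemma vect_iso (K : fieldType) (aT rT : vectType K) : dim aT = dim rT ->
  exists f : {linear aT -> rT}, bijective f.
Proof.
(* [pid_mx] is the identity matrix between the two dimensions, which are equal
   but not convertible *)
move=> dE; pose B : 'M[K]_(dim aT, dim rT) := pid_mx (dim aT).
pose C : 'M[K]_(dim rT, dim aT) := pid_mx (dim aT).
have BC : B *m C = 1%:M by rewrite pid_mx_id ?pid_mx_1 // dE.
have CB : C *m B = 1%:M by rewrite pid_mx_id // {1}dE pid_mx_1.
pose f (u : aT) : rT := r2v (v2r u *m B).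
have flin : linear f.
  by move=> c u v; rewrite /f linearP mulmxDl -scalemxAl linearP.
pose fL := GRing.isLinear.Build K aT rT _ f flin.
pose F : {linear aT -> rT} := HB.pack f fL.
exists F; exists (fun v => r2v (v2r v *m C)) => u /=.
  by rewrite /f r2vK -mulmxA BC mulmx1 v2rK.
by rewrite /f r2vK -mulmxA CB mulmx1 v2rK.
Qed.

Lemma additive_inverse (U V : zmodType) (f : {additive U -> V}) : bijective f ->
  exists g : {additive V -> U}, cancel f g /\ cancel g f.
Proof.
move=> [g fgK gfK]; have gadd := can2_zmod_morphism fgK gfK.
pose gA := GRing.isZmodMorphism.Build V U g gadd.
by exists (HB.pack g gA : {additive V -> U}).
Qed.

Context (R : realType) (n d : nat) (X Y : polyComplex R n d).

Lemma refines_parent : refines Y X ->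
  exists parent : 'I_(ncells Y) -> 'I_(ncells X), forall i, mcell i `<=` mcell (parent i).
Proof.
move=> YX; suff /fin_all_exists : forall i : 'I_(ncells Y), exists j : 'I_(ncells X),
    mcell i `<=` mcell j by [].
move=> i; have [s Xs is_] := YX.2 _ (mcell_cell i); have [j sj] := cell_sub_mcell Xs.
by exists j; apply: subset_trans sj.
Qed.

Lemma refines_Lambda : refines Y X -> exists f : {additive Lambda X -> Lambda Y}, bijective f.
Proof.
move=> YX; have [parent sub_parent] := refines_parent YX.
have pullP (w : Lambda X) : \row_i weight_of w 0 (parent i) \in @balanced_pred R n d Y.
  case: w => w /= /asboolP bw; apply/asboolP.
  exact: (balanced_pullback YX sub_parent bw).
pose f w := MkLambda (pullP w).
have fadd : zmod_morphism f.
  by move=> w w'; apply: val_inj; apply/rowP => i; rewrite /= !mxE.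
pose fA := GRing.isZmodMorphism.Build _ _ f fadd.
exists (HB.pack f fA : {additive Lambda X -> Lambda Y}) => /=.
have finj : injective f.
  move=> w w' /(congr1 val)/rowP ww'; apply: val_inj; apply/rowP => j.
  by have [i <-] := parent_surj YX sub_parent j; have := ww' i; rewrite !mxE.
have fsurj (w' : Lambda Y) : exists w, f w = w'.
  case: w' => w' bw'; have /asboolP := bw'.
  move=> /(balanced_descent YX sub_parent)[w /asboolP bw wE].
  by exists (MkLambda bw); apply: val_inj; rewrite /= wE.
have [g gP] := choice fsurj.
by exists g => // w; apply: finj; rewrite gP.
Qed.

(** The pull-back extends to an injective real linear map, which sends the
    generators of one span onto those of the other. *)
Lemma refines_dim_VX : refines Y X -> \dim (VX X) = \dim (VX Y).
Proof.
move=> YX; have [parent sub_parent] := refines_parent YX.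
pose f : 'Hom('rV[R]_(ncells X), 'rV[R]_(ncells Y)) := linfun (colsub parent).
have fE (w : 'rV[int]_(ncells X)) : f (toR R w) = toR R (\row_i w 0 (parent i)).
  by rewrite lfunE; apply/rowP => i; rewrite !mxE.
have /eqP f0 : lker f == 0%VS.
  apply/lker0P => v v'; rewrite !lfunE => /rowP vv'; apply/rowP => j.
  by have [i <-] := parent_surj YX sub_parent j; have := vv' i; rewrite !mxE.
rewrite -(limg_dim_eq (_ : VX X :&: lker f = 0)%VS); last by rewrite f0 capv0.
congr (\dim _); apply: subv_anti; apply/andP; split.
  apply/subvP => _ /memv_imgP[v vX ->]; rewrite memv_preim; apply: subvP vX.
  apply: vspan_min => _ [w bw ->]; rewrite -memv_preim fE; apply: mem_vspan.
  by exists (\row_i w 0 (parent i)) => //; apply: balanced_pullback.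
apply: vspan_min => _ [w' bw' ->].
have [w bw ->] := balanced_descent YX sub_parent bw'.
by rewrite -fE memv_img //; apply: mem_vspan; exists w.
Qed.

End Isomorphisms.

Theorem lemma3p15 (R : realType) (n d : nat) (X X' : polyStructure R n d)
    (XX' : same_cycle X X') :
  (exists f : {linear subvs_of (VX X) -> subvs_of (VX X')}, bijective f) /\
  (exists f : {additive Lambda X -> Lambda X'}, bijective f).
Proof.
have [_ [Y [wY [YX YX' _ _]]]] := XX'; split.
  by apply: vect_iso; rewrite -[LHS]/(\dim (VX X)) (refines_dim_VX YX) -(refines_dim_VX YX').
have [f [f' fK f'K]] := refines_Lambda YX.
have [g /additive_inverse[g' [gK g'K]]] := refines_Lambda YX'.
by exists (g' \o f : {additive _ -> _}); exists (f' \o g); apply: can_comp.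
Qed.
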